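(* Let $\alpha\in(0,1]$ and let $\mathcal C=(\mathcal C_t)_{t\ge0}$ be a candidate-family process. The following are equivalent: (i) $\mathcal C$ controls simultaneous stopped FDR at level $\alpha$; (ii) there exists a future-extension coherent dynamic intersection $e$-process collection $\mathbf E$ such that $\mathcal C_t\subseteq\mathfrak R_{\alpha,t}(\mathbf E)$ for every $t$.
   Context: Let $(\Omega,\mathcal F,(\mathcal F_t)_{t\in\mathbb N_0})$ be a discrete-time filtered measurable space, $\mathcal M$ a family of probability measures on $(\Omega,\mathcal F)$, $\mathcal I\subseteq\mathbb N$ an index set (finite or infinite), and $H_i\subseteq\mathcal M$, $i\in\mathcal I$, null hypotheses. Put $\mathcal N(P)=\{i\in\mathcal I:P\in H_i\}$ and, for finite $S\subseteq\mathcal I$, $H_S=\bigcap_{i\in S}H_i$ (with $H_\varnothing=\mathcal M$). The active sets $I_t\subseteq\mathcal I$ are deterministic and finite with $I_0\subseteq I_1\subseteq\cdots$ and $\bigcup_t I_t=\mathcal I$. For a finite $R\subseteq\mathcal I$ and any $S\subseteq\mathcal I$, $\mathrm{FDP}_S(R)=|S\cap R|/(|R|\vee 1)$. A candidate-family process $\mathcal C=(\mathcal C_t)_{t\ge0}$ consists of nonempty random families $\mathcal C_t\subseteq 2^{I_t}$ with $\{R\in\mathcal C_t\}\in\mathcal F_t$ for every deterministic $R\subseteq I_t$. It controls simultaneous stopped FDR at level $\alpha$ if $\mathbb E_P[\max_{R\in\mathcal C_\tau}\mathrm{FDP}_{\mathcal N(P)\cap I_\tau}(R)]\le\alpha$ for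 every $P\in\mathcal M$ and every $(\mathcal F_t)$-stopping time $\tau$ with $P(\tau<\infty)=1$. A nonnegative $(\mathcal F_t)$-adapted process $E=(E_t)_{t\ge0}$ is an $e$-process for $H\subseteq\mathcal M$ if $\mathbb E_P[E_\tau]\le1$ for every $P\in H$ and every $(\mathcal F_t)$-stopping time $\tau$ with $P(\tau<\infty)=1$. A dynamic intersection $e$-process collection is a family $\mathbf E=(E^S_t)_{t\ge0,\ S\subseteq\mathcal I,\ 0<|S|<\infty}$ such that $E^S=(E^S_t)_{t\ge0}$ is an $e$-process for $H_S$ for each nonempty finite $S$. It is future-extension coherent if, pointwise on $\Omega$, $E_t^{S\cap I_t}\le E_t^S$ for every $t$ and every finite $S$ with $S\cap I_t\ne\varnothing$. The closure family at time $t$ is $\mathfrak R_{\alpha,t}(\mathbf E)=\{R\subseteq I_t:\ \mathrm{FDP}_S(R)\le\alpha E^S_t\text{ for every nonempty }S\subseteq I_t\}$. *)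

(* Defs.v *)
From HB Require Import structures.
From mathcomp Require Import all_boot all_order all_algebra finmap.
From mathcomp Require Import all_classical all_reals all_analysis.

Set Implicit Arguments.
Unset Strict Implicit.
Unset Printing Implicit Defensive.

Import Order.TTheory GRing.Theory Num.Theory.

Local Open Scope classical_set_scope.
Local Open Scope ring_scope.

(* Finite sets of hypotheses are {fset nat}; a possibly infinite index set is
   a classical set nat, and [set` S] is the classical set underlying S.
   Random times with values in N u {oo} are maps Omega -> option nat, None
   standing for oo. *)

Definition is_filtration (d : measure_display) (Omega : measurableType d)
    (F : nat -> set (set Omega)) : Prop :=
  [/\ forall t, sigma_algebra setT (F t),
      forall t, F t `<=` @measurable d Omega &
      forall s t, (s <= t)%N -> F s `<=` F t].

Definition adapted (d : measure_display) (Omega : measurableType d)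
    (R : realType) (F : nat -> set (set Omega)) (X : nat -> Omega -> R) : Prop :=
  forall t (B : set R), measurable B -> F t (X t @^-1` B).

Definition stopping_time (d : measure_display) (Omega : measurableType d)
    (F : nat -> set (set Omega)) (tau : Omega -> option nat) : Prop :=
  forall t, F t [set w | exists2 s, tau w = Some s & (s <= t)%N].

Definition as_finite (d : measure_display) (Omega : measurableType d)
    (R : realType) (P : probability Omega R) (tau : Omega -> option nat) : Prop :=
  P [set w | tau w <> None] = 1%E.

(* The value 0 on {tau = oo} is a convention: stopped processes are only
   integrated against probabilities P with P(tau < oo) = 1. *)
Definition stopped (Omega : Type) (R : realType) (X : nat -> Omega -> R)
    (tau : Omega -> option nat) (w : Omega) : R :=
  if tau w is Some t then X t w else 0.

Definition FDP (R : realType) (S : set nat) (A : {fset nat}) : R :=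
  #|` [fset i in A | i \in S]%fset |%:R / (maxn #|` A | 1)%:R.

(* The active sets I_t of the index set Idx. *)
Definition active_sets (Idx : set nat) (It : nat -> {fset nat}) : Prop :=
  (forall s t, (s <= t)%N -> (It s `<=` It t)%fset) /\
  \bigcup_t [set` It t] = Idx.

(* N(P) *)
Definition true_nulls (d : measure_display) (Omega : measurableType d)
    (R : realType) (Idx : set nat) (H : nat -> set (probability Omega R))
    (P : probability Omega R) : set nat :=
  [set i | Idx i /\ H i P].

(* H_S; the conjunct M P yields H_S = M for empty S. *)
Definition intersection_null (d : measure_display) (Omega : measurableType d)
    (R : realType) (M : set (probability Omega R))
    (H : nat -> set (probability Omega R)) (S : {fset nat}) :
    set (probability Omega R) :=
  [set P | M P /\ forall i, i \in S -> H i P].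

Definition candidate_family_process (d : measure_display)
    (Omega : measurableType d) (F : nat -> set (set Omega))
    (It : nat -> {fset nat}) (C : nat -> Omega -> {fset {fset nat}}) : Prop :=
  [/\ forall t w, C t w != fset0,
      forall t w A, A \in C t w -> (A `<=` It t)%fset &
      forall t (A : {fset nat}), (A `<=` It t)%fset ->
        F t [set w | A \in C t w]].

(* The default 0 of the maximum is immaterial, as FDP is nonnegative and C t w
   is nonempty. *)
Definition max_FDP (Omega : Type) (R : realType) (S : set nat)
    (It : nat -> {fset nat}) (C : nat -> Omega -> {fset {fset nat}})
    (t : nat) (w : Omega) : R :=
  \big[Num.max/0]_(A <- C t w) FDP R (S `&` [set` It t]) A.

Definition controls_simultaneous_stopped_FDR (d : measure_display)
    (Omega : measurableType d) (R : realType) (F : nat -> set (set Omega))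
    (M : set (probability Omega R)) (Idx : set nat)
    (H : nat -> set (probability Omega R)) (It : nat -> {fset nat})
    (C : nat -> Omega -> {fset {fset nat}}) (alpha : R) : Prop :=
  forall P, M P -> forall tau, stopping_time F tau -> as_finite P tau ->
    ('E_P[stopped (max_FDP R (true_nulls Idx H P) It C) tau] <= alpha%:E)%E.

Definition e_process (d : measure_display) (Omega : measurableType d)
    (R : realType) (F : nat -> set (set Omega))
    (H0 : set (probability Omega R)) (E : nat -> Omega -> R) : Prop :=
  [/\ forall t w, 0 <= E t w,
      adapted F E &
      forall P, H0 P -> forall tau, stopping_time F tau -> as_finite P tau ->
        ('E_P[stopped E tau] <= 1)%E].

(* E S t is E^S_t; only the values at nonempty finite S included in Idx are
   meaningful, the others are unconstrained. *)
Definition dynamic_intersection_e_process_collection (d : measure_display)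
    (Omega : measurableType d) (R : realType) (F : nat -> set (set Omega))
    (M : set (probability Omega R)) (Idx : set nat)
    (H : nat -> set (probability Omega R))
    (E : {fset nat} -> nat -> Omega -> R) : Prop :=
  forall S : {fset nat}, S != fset0 -> [set` S] `<=` Idx ->
    e_process F (intersection_null M H S) (E S).

Definition future_extension_coherent (Omega : Type) (R : realType)
    (Idx : set nat) (It : nat -> {fset nat})
    (E : {fset nat} -> nat -> Omega -> R) : Prop :=
  forall t (S : {fset nat}), [set` S] `<=` Idx ->
    (S `&` It t)%fset != fset0 ->
    forall w, E (S `&` It t)%fset t w <= E S t w.

Definition closure_family (Omega : Type) (R : realType) (alpha : R)
    (It : nat -> {fset nat}) (E : {fset nat} -> nat -> Omega -> R)
    (t : nat) (w : Omega) : set {fset nat} :=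
  [set A | (A `<=` It t)%fset /\
     forall S : {fset nat}, S != fset0 -> (S `<=` It t)%fset ->
       FDP R [set` S] A <= alpha * E S t w].

(* Main.v *)
Require Import Defs.
From HB Require Import structures.
From mathcomp Require Import all_boot all_order all_algebra finmap.
From mathcomp Require Import all_classical all_reals all_analysis.
From mathcomp Require Import measurable_realfun.

Import Order.TTheory GRing.Theory Num.Theory.

Local Open Scope classical_set_scope.
Local Open Scope ring_scope.

(** Write N(P) for the set of true nulls under P.

    From control to e-processes, the candidate families supply their own
    evidence: E^S_t is 1 / alpha times the maximum over C_t of FDP_(S cap I_t).
    It depends on S only through S cap I_t, so coherence is an equality, and
    membership in the closure family holds by construction.  If P lies in H_S
    then S is included in N(P), so alpha E^S_t is at most the maximal FDP for
    N(P), and control at level alpha bounds the expectation of the stopped E^S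
    by 1 ([controls_closure]).  The process E^S is adapted
    because C_t takes its values among the finitely many families of subsets
    of I_t ([candidate_family_event]).

    Conversely, at each time t the maximal FDP is bounded by alpha times the
    e-value of the finite set N(P) cap I_t, but this set moves with t, so no
    single e-process is visible.  Coherence repairs this on a bounded horizon:
    for t <= m the e-value of N(P) cap I_t is at most that of
    S_m = N(P) cap I_m, whose e-process is valid under P.  Hence the
    expectation of the stopped maximal FDP restricted to tau <= m is at most
    alpha for every m.  As N(P) may be infinite, no largest S_m need exist;
    monotone convergence in m removes the horizon
    ([expectation_stopped_le_killed], [closure_controls]). *)

Set Implicit Arguments.
Unset Strict Implicit.

(** * Events determined by finitely many events *)

(** Splitting on whether the head of [s] is kept turns an event about the
    filtered list into two events about the filtered tail; quantifying over
    an arbitrary, not necessarily measurable, [Q] makes the induction go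
    through. *)
Lemma measurable_filter_event (d : measure_display) (T : measurableType d)
    (A : Type) (p : T -> pred A) (s : seq A) (Q : set (seq A)) :
  (forall a, measurable [set w | p w a]) ->
  measurable [set w | Q [seq a <- s | p w a]].
Proof.
move=> mp; elim: s Q => [|a s IHs] Q /=.
  have [q|nq] := pselect (Q [::]).
    by rewrite (_ : mkset _ = setT)//; apply/seteqP; split.
  by rewrite (_ : mkset _ = set0)//; apply/seteqP; split.
rewrite (_ : mkset _ =
  ([set w | p w a] `&` [set w | Q (a :: [seq b <- s | p w b])]) `|`
  (~` [set w | p w a] `&` [set w | Q [seq b <- s | p w b]])).
  apply: measurableU; apply: measurableI => //.
  - exact: (IHs (fun l => Q (a :: l))).
  - exact: measurableC.
apply/seteqP; split=> w /=; case: (p w a) => //=.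
- by left.
- by right.
- by move=> [[]|[]].
- by move=> [[]|[]].
Qed.

(** A candidate-family process only makes each membership event observable.
    This determines the whole family, since it is recovered by filtering the
    finite list of subsets of I_t. *)
Lemma candidate_family_event (d : measure_display) (Omega : measurableType d)
    (F : nat -> set (set Omega)) (It : nat -> {fset nat})
    (C : nat -> Omega -> {fset {fset nat}}) (Q : set {fset {fset nat}}) t :
  is_filtration F -> candidate_family_process F It C ->
  F t [set w | Q (C t w)].
Proof.
move=> [Fsigma _ _] [_ Csub Cev].
(* F t becomes the sigma-algebra of a measurable type, so that the closure
   properties of measurable sets apply to it. *)
rewrite -(measurable_g_measurableTypeE (Fsigma t)).
have CE w : C t w =
    [fset A | A in [seq A <- fpowerset (It t) | A \in C t w]]%fset.
  apply/fsetP => A; rewrite in_fset/= mem_filter fpowersetE.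
  by case: (boolP (A \in C t w)) => // /Csub ->.
under eq_set do rewrite CE.
apply: (@measurable_filter_event _ (g_sigma_algebraType (F t)) _
  (fun w A => A \in C t w) _ (fun l => Q [fset A | A in l]%fset)) => A.
rewrite (measurable_g_measurableTypeE (Fsigma t)).
(* Observability is only assumed for subsets of I_t; the other sets are never
   candidates. *)
have [AIt|nAIt] := boolP (A `<=` It t)%fset; first exact: Cev.
rewrite (_ : mkset _ = set0); first by case: (Fsigma t).
by apply/seteqP; split=> w //= /Csub; rewrite (negbTE nAIt).
Qed.

Lemma adapted_candidate_statistic (d : measure_display)
    (Omega : measurableType d) (R : realType) (F : nat -> set (set Omega))
    (It : nat -> {fset nat}) (C : nat -> Omega -> {fset {fset nat}})
    (f : nat -> {fset {fset nat}} -> R) :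
  is_filtration F -> candidate_family_process F It C ->
  adapted F (fun t w => f t (C t w)).
Proof.
move=> hF hC t B _.
exact: (candidate_family_event (fun D => B (f t D)) t hF hC).
Qed.

(** * Stopped processes *)

Lemma stopping_time_eq_event (d : measure_display) (Omega : measurableType d)
    (F : nat -> set (set Omega)) (tau : Omega -> option nat) t :
  is_filtration F -> stopping_time F tau ->
  measurable [set w | tau w = Some t].
Proof.
move=> [_ Fsub _] tauS.
have mle s : measurable [set w | exists2 r, tau w = Some r & (r <= s)%N].
  exact/Fsub/tauS.
rewrite (_ : mkset _ = [set w | exists2 r, tau w = Some r & (r <= t)%N] `\`
   \bigcup_(s in [set s | (s < t)%N])
     [set w | exists2 r, tau w = Some r & (r <= s)%N]).
  by apply: measurableD => //; apply: bigcup_measurable => s _.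
apply/seteqP; split=> w /=.
  move=> tw; split; first by exists t.
  move=> [s /= st [r]]; rewrite tw => -[<-] ts.
  by move: (leq_ltn_trans ts st); rewrite ltnn.
move=> [[r tw rt] nlt]; move: rt; rewrite leq_eqVlt => /orP[/eqP <- //|rt].
by exfalso; apply: nlt; exists r => //; exists r.
Qed.

(** The stopped process is the countable gluing of the [X t] along the events
    [tau = t], completed by the value 0 where [tau] is infinite. *)
Lemma measurable_stopped (d : measure_display) (Omega : measurableType d)
    (R : realType) (F : nat -> set (set Omega)) (X : nat -> Omega -> R)
    (tau : Omega -> option nat) :
  is_filtration F -> adapted F X -> stopping_time F tau ->
  measurable_fun setT (stopped X tau).
Proof.
move=> hF aX tauS _ B mB; rewrite setTI.
have mtau t := stopping_time_eq_event t hF tauS.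
have mfin : measurable [set w | tau w <> None].
  rewrite (_ : mkset _ = \bigcup_t [set w | tau w = Some t]).
    exact: bigcup_measurable.
  apply/seteqP; split=> w /=.
    by case E: (tau w) => [t|] // _; exists t.
  by move=> [t _ /= ->].
rewrite (_ : _ @^-1` _ =
  (\bigcup_t ([set w | tau w = Some t] `&` X t @^-1` B)) `|`
  (~` [set w | tau w <> None] `&` [set _ | B 0])).
  apply: measurableU.
    apply: bigcup_measurable => t _; apply: measurableI => //.
    by case: hF => _ Fsub _; apply/Fsub/aX.
  apply: measurableI; first exact: measurableC.
  have [B0|nB0] := pselect (B 0).
    by rewrite (_ : mkset _ = setT)//; apply/seteqP; split.
  by rewrite (_ : mkset _ = set0)//; apply/seteqP; split.
apply/seteqP; split=> w /=; rewrite /stopped.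
  case E: (tau w) => [t|] Bw; last by right; split => // /(_ E).
  by left; exists t.
by move=> [[t _ [/= -> //]]|[/contrapT -> //]].
Qed.

Lemma stopped_ge0 (Omega : Type) (R : realType) (X : nat -> Omega -> R)
    (tau : Omega -> option nat) w :
  (forall t w, 0 <= X t w) -> 0 <= stopped X tau w.
Proof. by rewrite /stopped; case: (tau w). Qed.

(** Both implications compare two stopped processes, one of which is dominated
    by a multiple of the other at all deterministic times. *)
Lemma expectation_stopped_le (d : measure_display) (Omega : measurableType d)
    (R : realType) (F : nat -> set (set Omega)) (P : probability Omega R)
    (X Y : nat -> Omega -> R) (c : R) (tau : Omega -> option nat) :
  is_filtration F -> stopping_time F tau -> adapted F X -> adapted F Y ->
  0 <= c -> (forall t w, 0 <= X t w) -> (forall t w, 0 <= Y t w) ->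
  (forall t w, X t w <= c * Y t w) ->
  ('E_P[stopped X tau] <= c%:E * 'E_P[stopped Y tau])%E.
Proof.
move=> hF tauS aX aY c0 X0 Y0 XY.
have mX := measurable_stopped hF aX tauS.
have mY := measurable_stopped hF aY tauS.
rewrite unlock -ge0_integralZl_EFin//; last 2 first.
- by move=> w _; rewrite lee_fin stopped_ge0.
- exact/measurable_EFinP.
apply: ge0_le_integral => //.
- by move=> w _; rewrite lee_fin stopped_ge0.
- exact/measurable_EFinP.
- by apply: measurable_funeM; exact/measurable_EFinP.
- move=> w _; rewrite -EFinM lee_fin /stopped.
  by case: (tau w) => // ; rewrite mulr0.
Qed.

(** Killing the process at a horizon, rather than the stopping time, keeps the
    stopping time fixed, and the killed processes increase to [X] with the
    horizon. *)
Definition killed_after (Omega : Type) (R : realType) (m : nat)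
    (X : nat -> Omega -> R) : nat -> Omega -> R :=
  fun t w => if (t <= m)%N then X t w else 0.

Lemma adapted_killed_after (d : measure_display) (Omega : measurableType d)
    (R : realType) (F : nat -> set (set Omega)) (X : nat -> Omega -> R) m :
  is_filtration F -> adapted F X -> adapted F (killed_after m X).
Proof.
move=> [Fsigma _ _] aX t B mB; rewrite /killed_after.
case: leqP => _; first exact: aX.
rewrite -(measurable_g_measurableTypeE (Fsigma t)) preimage_cst.
by case: ifP.
Qed.

(** Monotone convergence: at each outcome the stopped killed process is
    eventually equal to the stopped process, also where [tau] is infinite,
    since both are 0 there. *)
Lemma expectation_stopped_le_killed (d : measure_display)
    (Omega : measurableType d) (R : realType) (F : nat -> set (set Omega))
    (P : probability Omega R) (X : nat -> Omega -> R)
    (tau : Omega -> option nat) (c : \bar R) :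
  is_filtration F -> stopping_time F tau -> adapted F X ->
  (forall t w, 0 <= X t w) ->
  (forall m, 'E_P[stopped (killed_after m X) tau] <= c)%E ->
  ('E_P[stopped X tau] <= c)%E.
Proof.
move=> hF tauS aX X0 le_c.
pose g m w := (stopped (killed_after m X) tau w)%:E.
have g0 m w : (0 <= g m w)%E.
  rewrite lee_fin; apply: stopped_ge0 => t v.
  by rewrite /killed_after; case: ifP.
have mg m : measurable_fun setT (g m).
  apply/measurable_EFinP/(measurable_stopped hF) => //.
  exact: adapted_killed_after.
have ndg w : {homo g^~ w : m n / (m <= n)%N >-> (m <= n)%E}.
  move=> m n mn; rewrite lee_fin /stopped /killed_after.
  case: (tau w) => // t; case: leqP => [tm|_]; first by rewrite (leq_trans tm).
  by case: ifP.
have limg w : limn (g^~ w) = (stopped X tau w)%:E.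
  apply/cvg_lim => //; rewrite /g /stopped.
  case: (tau w) => [t|]; last exact: cvg_cst.
  apply: cvg_near_cst; exists t => // n /= tn.
  by rewrite /killed_after tn.
rewrite unlock.
have -> : (\int[P]_w (stopped X tau w)%:E = \int[P]_w limn (g^~ w))%E.
  by apply: eq_integral => w _; rewrite limg.
have cvgg := @cvg_monotone_convergence _ _ _ P setT measurableT g mg
  (fun m w _ => g0 m w) (fun w _ => ndg w).
rewrite -(cvg_lim _ cvgg)//; apply: lime_le; first exact: cvgP cvgg.
by apply: nearW => m; have := le_c m; rewrite unlock.
Qed.

(** * False discovery proportions *)

Lemma le_FDP (R : realType) (S T : set nat) (A : {fset nat}) :
  S `<=` T -> FDP R S A <= FDP R T A.
Proof.
move=> ST; rewrite /FDP ler_wpM2r ?invr_ge0// ler_nat.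
apply: fsubset_leq_card; apply/fsubsetP => i; rewrite !inE/= => /andP[-> /=].
by rewrite !inE => /ST.
Qed.

Lemma FDP_set0 (R : realType) (A : {fset nat}) : FDP R set0 A = 0.
Proof.
rewrite /FDP (_ : [fset i in A | i \in set0]%fset = fset0) ?cardfs0 ?mul0r//.
by apply/fsetP => i; rewrite !inE/= in_set0 andbF.
Qed.

Lemma max_FDP_ge0 (Omega : Type) (R : realType) (S : set nat)
    (It : nat -> {fset nat}) (C : nat -> Omega -> {fset {fset nat}}) t w :
  0 <= max_FDP R S It C t w.
Proof. exact: bigmax_ge_id. Qed.

Lemma FDP_le_max_FDP (Omega : Type) (R : realType) (S : set nat)
    (It : nat -> {fset nat}) (C : nat -> Omega -> {fset {fset nat}}) t w A :
  A \in C t w -> FDP R (S `&` [set` It t]) A <= max_FDP R S It C t w.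
Proof. by move=> ACt; exact: le_bigmax_seq. Qed.

Lemma max_FDP_le (Omega : Type) (R : realType) (S : set nat)
    (It : nat -> {fset nat}) (C : nat -> Omega -> {fset {fset nat}}) t w c :
  0 <= c ->
  (forall A, A \in C t w -> FDP R (S `&` [set` It t]) A <= c) ->
  max_FDP R S It C t w <= c.
Proof.
move=> c0 Ac; rewrite /max_FDP big_seq_cond; apply: bigmax_le => // A.
by rewrite andbT; exact: Ac.
Qed.

Lemma le_max_FDP (Omega : Type) (R : realType) (S T : set nat)
    (It : nat -> {fset nat}) (C : nat -> Omega -> {fset {fset nat}}) t w :
  S `<=` T -> max_FDP R S It C t w <= max_FDP R T It C t w.
Proof.
move=> ST; apply: max_FDP_le => [|A ACt]; first exact: max_FDP_ge0.
apply: le_trans (FDP_le_max_FDP R T It ACt); apply: le_FDP; exact: setSI.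
Qed.

(** * The two implications *)

(** The witness is the maximal FDP for S itself, rescaled by 1 / alpha; under
    P in H_S it is dominated by the maximal FDP for the true nulls. *)
Lemma controls_closure (d : measure_display) (Omega : measurableType d)
    (R : realType) (F : nat -> set (set Omega)) (M : set (probability Omega R))
    (Idx : set nat) (H : nat -> set (probability Omega R))
    (It : nat -> {fset nat}) (alpha : R)
    (C : nat -> Omega -> {fset {fset nat}}) :
  is_filtration F -> 0 < alpha -> candidate_family_process F It C ->
  controls_simultaneous_stopped_FDR F M Idx H It C alpha ->
  exists E : {fset nat} -> nat -> Omega -> R,
    [/\ dynamic_intersection_e_process_collection F M Idx H E,
        future_extension_coherent Idx It E &
        forall t w, [set` C t w] `<=` closure_family alpha It E t w].
Proof.
move=> hF alpha0 hC ctrl.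
have aC f := @adapted_candidate_statistic _ _ R F It C f hF hC.
pose maxF S t (D : {fset {fset nat}}) :=
  \big[Num.max/0]_(A <- D) FDP R (S `&` [set` It t]) A.
have aX S : adapted F (fun t w => alpha^-1 * max_FDP R S It C t w).
  exact: (aC (fun t D => alpha^-1 * maxF S t D)).
exists (fun S t w => alpha^-1 * max_FDP R [set` S] It C t w).
have E0 S t w : 0 <= alpha^-1 * max_FDP R [set` S] It C t w.
  by rewrite mulr_ge0 ?invr_ge0 ?(ltW alpha0) ?max_FDP_ge0.
split.
- move=> S _ SIdx; split => [//||P [MP HP] tau tauS tauP]; first exact: aX.
  have aN : adapted F (max_FDP R (true_nulls Idx H P) It C).
    exact: (aC (maxF (true_nulls Idx H P))).
  have SN : [set` S] `<=` true_nulls Idx H P.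
    by move=> i iS; split; [exact: SIdx|exact: HP].
  have ai0 : 0 <= alpha^-1 by rewrite invr_ge0 ltW.
  apply: (le_trans (expectation_stopped_le P hF tauS (aX _) aN ai0 _ _ _)).
  + by [].
  + exact: max_FDP_ge0.
  + by move=> t w; rewrite ler_wpM2l// le_max_FDP.
  + apply: (@le_trans _ _ (alpha^-1%:E * alpha%:E)%E).
      by apply: lee_wpmul2l; [rewrite lee_fin|exact: ctrl].
    by rewrite -EFinM mulVf ?gt_eqF.
- move=> t S _ _ w; rewrite ler_wpM2l ?invr_ge0 ?(ltW alpha0)//.
  by apply: le_max_FDP => i /=; rewrite inE => /andP[].
- move=> t w A /= ACt; have [_ Csub _] := hC; split; first exact: Csub ACt.
  move=> S _ SIt; rewrite mulrA divff ?gt_eqF// mul1r.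
  have := FDP_le_max_FDP R [set` S] It ACt.
  by rewrite (@setIidl _ [set` S])// => i /= iS; exact: (fsubsetP SIt).
Qed.

(** Before the horizon m, coherence replaces the moving set of active true
    nulls by the fixed finite set of those active at m, for which a single
    e-process is available. *)
Lemma closure_controls (d : measure_display) (Omega : measurableType d)
    (R : realType) (F : nat -> set (set Omega)) (M : set (probability Omega R))
    (Idx : set nat) (H : nat -> set (probability Omega R))
    (It : nat -> {fset nat}) (alpha : R)
    (C : nat -> Omega -> {fset {fset nat}})
    (E : {fset nat} -> nat -> Omega -> R) :
  is_filtration F -> (forall s t, (s <= t)%N -> (It s `<=` It t)%fset) ->
  0 <= alpha -> candidate_family_process F It C ->
  dynamic_intersection_e_process_collection F M Idx H E ->
  future_extension_coherent Idx It E ->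
  (forall t w, [set` C t w] `<=` closure_family alpha It E t w) ->
  controls_simultaneous_stopped_FDR F M Idx H It C alpha.
Proof.
move=> hF It_nd alpha0 hC eE cE CE P MP tau tauS tauP.
set N := true_nulls Idx H P.
have aN : adapted F (max_FDP R N It C).
  exact: (adapted_candidate_statistic (fun t D =>
    \big[Num.max/0]_(A <- D) FDP R (N `&` [set` It t]) A) hF hC).
apply: (expectation_stopped_le_killed hF tauS aN) => [|m].
  exact: max_FDP_ge0.
pose NI t := [fset i in It t | i \in N]%fset.
have NIE t : [set` NI t] = N `&` [set` It t].
  apply/seteqP; split=> i /=; rewrite !inE/=.
    by move=> /andP[? ]; rewrite inE.
  by move=> [? ->]; rewrite /= mem_set.
have NI_Idx t : [set` NI t] `<=` Idx by rewrite NIE => i [[]].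
have FDP_le t w A : (t <= m)%N -> NI m != fset0 -> A \in C t w ->
    FDP R (N `&` [set` It t]) A <= alpha * E (NI m) t w.
  move=> tm NIm0 ACt; rewrite -NIE.
  have [->|NIt0] := eqVneq (NI t) fset0.
    rewrite set_fset0 FDP_set0 mulr_ge0//.
    by have [E0 _ _] := eE _ NIm0 (NI_Idx m); exact: E0.
  (* Coherence compares an extension with its active part: here the active
     part at t of the true nulls at horizon m. *)
  have NImt : (NI m `&` It t)%fset = NI t.
    apply/fsetP => i; rewrite !inE/= andbAC; case: (boolP (i \in It t)) => iIt.
      by rewrite (fsubsetP (It_nd _ _ tm) _ iIt).
    by rewrite andbF.
  have [_ closed] := CE t w A ACt.
  apply: (le_trans (closed _ NIt0 (fset_sub _ _))).
  by rewrite ler_wpM2l// -NImt; apply: cE; rewrite ?NImt.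
(* With no true null active up to m there is no e-process to use, and the
   killed maximal FDP vanishes. *)
have [NIm0|NIm0] := eqVneq (NI m) fset0.
  have killed0 : stopped (killed_after m (max_FDP R N It C)) tau = cst 0.
    apply/funext => w; rewrite /stopped /killed_after; case: (tau w) => // t.
    case: leqP => // tm; apply/le_anti; rewrite max_FDP_ge0 andbT.
    apply: max_FDP_le => // A _.
    have NItm : N `&` [set` It t] `<=` set0.
      by rewrite -set_fset0 -NIm0 NIE; apply: setIS => i; exact/fsubsetP/It_nd.
    by apply: (le_trans (le_FDP R A NItm)); rewrite FDP_set0.
  by rewrite killed0 expectation_cst lee_fin.
have [E0 aE eEm] := eE _ NIm0 (NI_Idx m).
apply: (le_trans (expectation_stopped_le P hF tauS
  (adapted_killed_after m hF aN) aE alpha0 _ E0 _)) => [t w|t w|].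
- by rewrite /killed_after; case: ifP => // _; exact: max_FDP_ge0.
- rewrite /killed_after; case: leqP => tm; last by rewrite mulr_ge0.
  apply: max_FDP_le => [|A]; first by rewrite mulr_ge0.
  exact: FDP_le.
- rewrite -[leRHS]mule1; apply: lee_wpmul2l; first by rewrite lee_fin.
  apply: eEm => //; split => // i; rewrite !inE /= => /andP[_].
  by rewrite inE => -[].
Qed.

Unset Implicit Arguments.
Set Strict Implicit.

Theorem theorem3p10 (d : measure_display) (Omega : measurableType d)
    (R : realType) (F : nat -> set (set Omega)) (hF : is_filtration F)
    (M : set (probability Omega R)) (Idx : set nat)
    (H : nat -> set (probability Omega R))
    (hH : forall i, Idx i -> H i `<=` M)
    (It : nat -> {fset nat}) (hIt : active_sets Idx It)
    (alpha : R) (halpha0 : 0 < alpha) (halpha1 : alpha <= 1)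
    (C : nat -> Omega -> {fset {fset nat}})
    (hC : candidate_family_process F It C) :
  controls_simultaneous_stopped_FDR F M Idx H It C alpha <->
  exists E : {fset nat} -> nat -> Omega -> R,
    [/\ dynamic_intersection_e_process_collection F M Idx H E,
        future_extension_coherent Idx It E &
        forall t w, [set` C t w] `<=` closure_family alpha It E t w].
Proof.
split; first exact: controls_closure.
move=> [E [eE cE CE]]; have [It_nd _] := hIt.
exact: closure_controls (ltW halpha0) hC eE cE CE.
Qed.
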